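(* Let $n\ge 1$, let $I_k\ge 0$ and $D_k>0$ be real numbers for $k=1,\ldots,n$, and let $R\in\mathbb{Z}_{\ge 0}$. Put $\tau_{\mathrm{all}}=\frac{R+\sum_{k=1}^n I_k}{\sum_{k=1}^n D_k}$ and $T_k=\tau_{\mathrm{all}}D_k$. Consider the sum-of-deviations problem $$\text{(SD)}\qquad \min_{\boldsymbol{x}}\ \sum_{k=1}^n\left|\frac{I_k+x_k}{D_k}-\tau_{\mathrm{all}}\right|\quad\text{s.t.}\quad \sum_{k=1}^n x_k=R,\quad x_k\in\mathbb{Z}_{\ge 0},\ k=1,\ldots,n,$$ and the linearized sum-of-deviations problem $$\text{(LSD)}\qquad \min_{\boldsymbol{x},\boldsymbol{\delta}}\ \sum_{k=1}^n\frac{1}{D_k}\delta_k\quad\text{s.t.}\quad \begin{cases}\delta_k\ge I_k+x_k-T_k, & k=1,\ldots,n,\\ \delta_k\ge -I_k-x_k+T_k, & k=1,\ldots,n,\\ \sum_{k=1}^n x_k=R,\\ x_k\in\mathbb{Z}_{\ge 0},\ \delta_k\ge 0, & k=1,\ldots,n,\end{cases}$$ where $\boldsymbol{x}=(x_1,\ldots,x_n)^\top$ and $\boldsymbol{\delta}=(\delta_1,\ldots,\delta_n)^\top$ with $\delta_k$ real. Then (SD) and (LSD) are equivalent: they have the same optimal objective value and the same set of optimal allocations, i.e. $\boldsymbol{x}$ is an optimal solution of (SD) if and only if there exists $\boldsymbol{\delta}$ such that $(\boldsymbol{x},\boldsymbol{\delta})$ is an optimal solution of (LSD).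
   Context: Setting: a total integer replenishment quantity $R$ is to be allocated over $n$ warehouses; $I_k$ is the on-hand inventory and $D_k$ the forecast daily demand at warehouse $k$, and $x_k$ is the quantity allocated to warehouse $k$. The system-level target inventory days are $\tau_{\mathrm{all}}=\sum_k(I_k+x_k)/\sum_k D_k$, which by the conservation constraint $\sum_k x_k=R$ is the instance constant $(R+\sum_k I_k)/\sum_k D_k$; the target inventory level of warehouse $k$ is $T_k=\tau_{\mathrm{all}}D_k$. *)

(* Defs.v *)
From mathcomp Require Import all_boot all_order all_algebra.
From mathcomp Require Import reals.

Set Implicit Arguments.
Unset Strict Implicit.
Unset Printing Implicit Defensive.

Import Order.TTheory GRing.Theory Num.Theory.
Local Open Scope ring_scope.

Definition optimal_solution (R : realType) (X : Type)
    (feasible : X -> Prop) (objective : X -> R) (x : X) : Prop :=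
  feasible x /\ (forall y, feasible y -> objective x <= objective y).

(* The minimum is required to be attained, so an infeasible or unbounded
   problem, or one with an unattained infimum, has no optimal value. *)
Definition optimal_value (R : realType) (X : Type)
    (feasible : X -> Prop) (objective : X -> R) (v : R) : Prop :=
  exists x, optimal_solution feasible objective x /\ objective x = v.

(* In what follows Inv k is the on-hand inventory I_k, D k the daily demand D_k
   and Q the total replenishment quantity R of the mathematical text; the
   constraint that x_k is a nonnegative integer is the type nat of x k. *)

Definition tau_all (R : realType) (n : nat) (Inv D : 'I_n -> R) (Q : nat) : R :=
  (Q%:R + \sum_(k < n) Inv k) / \sum_(k < n) D k.

Definition target (R : realType) (n : nat) (Inv D : 'I_n -> R) (Q : nat)
    (k : 'I_n) : R :=
  tau_all Inv D Q * D k.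

Definition sd_feasible (n : nat) (Q : nat) (x : 'I_n -> nat) : Prop :=
  (\sum_(k < n) x k = Q)%N.

Definition sd_objective (R : realType) (n : nat) (Inv D : 'I_n -> R) (Q : nat)
    (x : 'I_n -> nat) : R :=
  \sum_(k < n) `|(Inv k + (x k)%:R) / D k - tau_all Inv D Q|.

Definition lsd_feasible (R : realType) (n : nat) (Inv D : 'I_n -> R) (Q : nat)
    (z : ('I_n -> nat) * ('I_n -> R)) : Prop :=
  let: (x, delta) := z in
  [/\ forall k, delta k >= Inv k + (x k)%:R - target Inv D Q k,
      forall k, delta k >= - Inv k - (x k)%:R + target Inv D Q k,
      (\sum_(k < n) x k = Q)%N
    & forall k, delta k >= 0].

Definition lsd_objective (R : realType) (n : nat) (D : 'I_n -> R)
    (z : ('I_n -> nat) * ('I_n -> R)) : R :=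
  \sum_(k < n) 1 / D k * z.2 k.

Definition sd_optimal (R : realType) (n : nat) (Inv D : 'I_n -> R) (Q : nat)
    (x : 'I_n -> nat) : Prop :=
  optimal_solution (sd_feasible Q) (sd_objective Inv D Q) x.

Definition lsd_optimal (R : realType) (n : nat) (Inv D : 'I_n -> R) (Q : nat)
    (x : 'I_n -> nat) (delta : 'I_n -> R) : Prop :=
  optimal_solution (lsd_feasible Inv D Q) (lsd_objective D) (x, delta).

(* Main.v *)
Require Import Defs.
From mathcomp Require Import all_boot all_order all_algebra.
From mathcomp Require Import reals.

Import Order.TTheory GRing.Theory Num.Theory.
Local Open Scope ring_scope.

(** For a fixed allocation [x], the two linear constraints on [delta k] say
    that [delta k] bounds [`|Inv k + x k - target k|] from above, and the
    weight [1 / D k > 0] turns this into a bound on the [k]-th deviation in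
    days. Minimising over [delta] first therefore gives back the objective of
    the sum-of-deviations problem, the minimum being attained at the deviation
    itself ([deviation_le_lsd_objective], [lsd_objective_deviation]). So the
    linearised problem is a lift of the original one: every feasible point
    projects to a feasible point of no larger objective, and every feasible
    point lifts to one of the same objective. Optimal solutions then correspond
    under lifting and projection ([optimal_solution_lift],
    [optimal_solution_proj]).

    A common optimal value also requires the minimum to be attained. It is,
    because the conservation constraint bounds each [x k] by [Q]: only finitely
    many allocations are feasible, and at least one is
    ([sd_optimal_exists]). *)

(** Partial minimisation in general: the section [s] chooses, for each [x], a
    second component at which [g] attains its lower bound [f x] over the fibre
    of [P'] above [x]. Minimising [g] is then the same as minimising [f]. *)
Section Lift.

Variables (R : realType) (X Y : Type).
Variables (P : X -> Prop) (f : X -> R) (P' : X * Y -> Prop) (g : X * Y -> R).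
Variable s : X -> Y.
Hypothesis feasible_proj : forall x y, P' (x, y) -> P x.
Hypothesis feasible_lift : forall x, P x -> P' (x, s x).
Hypothesis objective_proj : forall x y, P' (x, y) -> f x <= g (x, y).
Hypothesis objective_lift : forall x, g (x, s x) = f x.

Lemma optimal_solution_lift x :
  optimal_solution P f x -> optimal_solution P' g (x, s x).
Proof.
move=> [Px xmin]; split; first exact: feasible_lift.
move=> [y d] P'yd; rewrite objective_lift.
by apply: le_trans (objective_proj _ _ P'yd); apply/xmin/(feasible_proj _ _ P'yd).
Qed.

Lemma optimal_solution_proj x y :
  optimal_solution P' g (x, y) -> optimal_solution P f x.
Proof.
move=> [P'xy xymin]; split; first exact: feasible_proj P'xy.
move=> z Pz; apply: le_trans (objective_proj _ _ P'xy) _.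
by rewrite -[leRHS]objective_lift; apply/xymin/feasible_lift.
Qed.

End Lift.

Arguments optimal_solution_lift {R X Y P f P' g s}.
Arguments optimal_solution_proj {R X Y P f P' g s}.

Section Deviations.

Variables (R : realType) (n : nat) (Inv D : 'I_n -> R) (Q : nat).

(** Measured in units of stock; dividing by [D k] gives the deviation in
    days. *)
Definition deviation (x : 'I_n -> nat) (k : 'I_n) : R :=
  `|Inv k + (x k)%:R - target Inv D Q k|.

Lemma lsd_feasible_deviation x :
  sd_feasible Q x -> lsd_feasible Inv D Q (x, deviation x).
Proof.
move=> xQ; split=> // k; rewrite /deviation ?ler_norm //.
by rewrite -normrN !opprD opprK ler_norm.
Qed.

Lemma deviation_le x delta k :
  lsd_feasible Inv D Q (x, delta) -> deviation x k <= delta k.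
Proof.
move=> [hp hm _ _]; rewrite /deviation ler_norml hp andbT lerNl.
by rewrite !opprD opprK.
Qed.

Hypothesis hD : forall k, 0 < D k.

(** As [D k > 0], the weight [1 / D k] can be moved inside the absolute value,
    where it turns stock into days. *)
Lemma lsd_objective_deviation x :
  lsd_objective D (x, deviation x) = sd_objective Inv D Q x.
Proof.
apply: eq_bigr => k _ /=; have Dk := hD k.
rewrite /deviation /target -[X in X * `|_|]gtr0_norm ?divr_gt0 // -normrM.
by rewrite mulrBr mul1r mulrC [_^-1 * _]mulrC mulfK ?gt_eqF.
Qed.

Lemma deviation_le_lsd_objective x delta :
  lsd_feasible Inv D Q (x, delta) ->
  sd_objective Inv D Q x <= lsd_objective D (x, delta).
Proof.
move=> xd; rewrite -lsd_objective_deviation; apply: ler_sum => k _ /=.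
by rewrite ler_pM2l ?divr_gt0 // deviation_le.
Qed.

End Deviations.

(** Each coordinate of a feasible allocation is at most [Q], so the search
    space can be replaced by the finite type of functions into ['I_Q.+1]. *)
Lemma sd_optimal_exists (R : realType) (n : nat) (Inv D : 'I_n -> R) (Q : nat) :
  (0 < n)%N -> exists x, sd_optimal Inv D Q x.
Proof.
move=> n_gt0.
pose F := [pred h : {ffun 'I_n -> 'I_Q.+1} | \sum_k h k == Q :> nat]%N.
pose obj (h : {ffun 'I_n -> 'I_Q.+1}) :=
  sd_objective Inv D Q (fun k => h k : nat).
(* Sending everything to one warehouse is feasible. *)
pose i0 := Ordinal n_gt0.
pose h0 : {ffun 'I_n -> 'I_Q.+1} :=
  [ffun k => if k == i0 then ord_max else ord0].
have Fh0 : F h0.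
  rewrite /= (bigD1 i0) //= big1 => [|k /negPf ki0]; last by rewrite ffunE ki0.
  by rewrite ffunE eqxx addn0.
have [h /eqP hQ hmin] := arg_minP obj Fh0.
exists (fun k => h k : nat); split=> // y yQ.
have yleQ k : (y k < Q.+1)%N by rewrite ltnS -yQ (bigD1 k) //= leq_addr.
pose h' : {ffun 'I_n -> 'I_Q.+1} := [ffun k => Ordinal (yleQ k)].
have h'E k : h' k = y k :> nat by rewrite ffunE.
have -> : sd_objective Inv D Q y = obj h'.
  by apply: eq_bigr => k _; rewrite h'E.
by apply: hmin; apply/eqP; rewrite -[RHS]yQ; apply: eq_bigr.
Qed.

Theorem theorem1 (R : realType) (n : nat) (Inv D : 'I_n -> R) (Q : nat)
    (hn : (1 <= n)%N) (hInv : forall k, 0 <= Inv k) (hD : forall k, 0 < D k) :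
  (exists v : R,
      optimal_value (sd_feasible Q) (sd_objective Inv D Q) v /\
      optimal_value (lsd_feasible Inv D Q) (lsd_objective D) v) /\
  (forall x : 'I_n -> nat,
      sd_optimal Inv D Q x <-> exists delta, lsd_optimal Inv D Q x delta).
Proof.
have proj x delta : lsd_feasible Inv D Q (x, delta) -> sd_feasible Q x by case.
have lift := lsd_feasible_deviation R n Inv D Q.
have le := deviation_le_lsd_objective R n Inv D Q hD.
have eq := lsd_objective_deviation R n Inv D Q hD.
have opt_lift := optimal_solution_lift proj lift le eq.
have opt_proj := optimal_solution_proj proj lift le eq.
split; last first.
  move=> x; split=> [xopt | [delta]]; last exact: opt_proj.
  by exists (deviation R n Inv D Q x); apply: opt_lift.
have [x xopt] := sd_optimal_exists R n Inv D Q hn.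
exists (sd_objective Inv D Q x); split; first by exists x.
by exists (x, deviation R n Inv D Q x); split; [apply: opt_lift | apply: eq].
Qed.
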